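(* If $f_1,f_2\in\mathcal A_c(\mathbb R^2)$ have respective primitives $F_1,F_2\in\mathcal B_c(\overline{\mathbb R}^2)$, define their product by $f_1f_2=\partial_{12}(F_1F_2)$. Then $\mathcal A_c(\mathbb R^2)$ is a commutative Banach algebra without unit, with approximate identity, isomorphic to $\mathcal B_c(\overline{\mathbb R}^2)$.
   Context: $\overline{\mathbb R}=[-\infty,\infty]$ is the two-point compactification of $\mathbb R$, and $\overline{\mathbb R}^2$ carries the product topology. $\mathcal B_c(\overline{\mathbb R}^2)$ is the Banach space (uniform norm) of continuous $F:\overline{\mathbb R}^2\to\mathbb R$ with $F(-\infty,s)=F(s,-\infty)=0$ for all $s\in\overline{\mathbb R}$; it is a commutative Banach algebra under pointwise multiplication. $\partial_{12}=\partial_1\partial_2$ is the distributional derivative on $\mathbb R^2$, and $\mathcal A_c(\mathbb R^2)=\{\partial_{12}F\mid F\in\mathcal B_c(\overline{\mathbb R}^2)\}\subset\mathcal D'(\mathbb R^2)$; the primitive $F\in\mathcal B_c(\overline{\mathbb R}^2)$ of $f=\partial_{12}F$ is unique and $\mathcal A_c(\mathbb R^2)$ has the Alexiewicz norm $\lVert f\rVert=\lVert F\rVert_\infty$. A commutative Banach algebra is a real Banach space $V$ with a bilinear, associative, commutative multiplication satisfying $\lVert uv\rVert_V\le\lVert u\rVert_V\lVert v\rVert_V$. An approximate identity is a sequence $(u_n)\subset V$ with $\lVert v-u_nv\rVert_V\to0$ for every $v\in V$. *)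

(* Defs.v *)
From HB Require Import structures.
From mathcomp Require Import all_boot all_order all_algebra.
From mathcomp Require Import all_classical all_reals all_analysis.
From mathcomp Require Import measurable_realfun ring.

Set Implicit Arguments.
Unset Strict Implicit.
Unset Printing Implicit Defensive.

Import Order.TTheory GRing.Theory Num.Theory.
Import numFieldNormedType.Exports.

Local Open Scope classical_set_scope.
Local Open Scope ring_scope.

(* A boolean selects a variable of the plane: false the first, true the
   second. *)
Definition coord (R : realType) (i : bool) (z : R * R) : R :=
  if i then z.2 else z.1.

Definition line (R : realType) (i : bool) (z : R * R) (t : R) : R * R :=
  if i then (z.1, t) else (t, z.2).

(* [line i z t] is [z] with its [i]-th coordinate replaced by [t], so [pder i]
   is the [i]-th partial derivative. *)
Definition pder (R : realType) (i : bool) (f : R * R -> R) (z : R * R) : R :=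
  (fun t => f (line i z t))^`()%classic (coord i z).

Definition pders (R : realType) (w : seq bool) (f : R * R -> R) : R * R -> R :=
  foldr (@pder R) f w.

Definition smooth (R : realType) (f : R * R -> R) : Prop :=
  forall w : seq bool, continuous (pders w f) /\
    forall i z, derivable (fun t => pders w f (line i z t)) (coord i z) 1.

Definition supp (R : realType) (f : R * R -> R) : set (R * R) :=
  closure [set z | f z != 0].

Definition test_pred (R : realType) : {pred R * R -> R} :=
  fun f => `[< smooth f /\ compact (supp f) >].

Record testfun (R : realType) := TestFun {
  test_val :> R * R -> R ;
  test_valP : test_val \in @test_pred R }.

HB.instance Definition _ (R : realType) := [isSub for @test_val R].
HB.instance Definition _ (R : realType) := [Choice of testfun R by <:].

Section test_functions.
Context (R : realType).
Implicit Types (f g : R * R -> R) (w : seq bool) (i : bool) (a : R).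

Lemma pders_lin w f g a : smooth f -> smooth g ->
  pders w (a *: f + g) = a *: pders w f + pders w g.
Proof.
move=> sf sg; elim: w => //= i w ->; apply/funext => z.
rewrite /pder derive1E.
have [_ /(_ i z) df] := sf w; have [_ /(_ i z) dg] := sg w.
have -> : (fun t => (a *: pders w f + pders w g) (line i z t)) =
   (a *: (fun t => pders w f (line i z t))) + (fun t => pders w g (line i z t)).
  by [].
by rewrite deriveD ?deriveZ -?derive1E//; exact: derivableZ.
Qed.

Lemma supp_lin f g a : supp (a *: f + g) `<=` supp f `|` supp g.
Proof.
rewrite /supp -closureU; apply: closureS => z /=; apply: contraPP.
move/not_orP => [/negP + /negP]; rewrite !negbK => /eqP f0 /eqP g0.
apply/negP; rewrite negbK.
have -> : (a *: f + g) z = a * f z + g z by [].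
by rewrite f0 g0 mulr0 addr0.
Qed.

Lemma test_submod_closed : submod_closed (@test_pred R).
Proof.
have sm0 : smooth (0 : R * R -> R).
  have E w : pders w (0 : R * R -> R) = 0.
    elim: w => //= i w ->; apply/funext => z; rewrite /pder derive1E.
    exact: (@derive_cst _ _ _ (0 : R)).
  move=> w; rewrite E; split; first exact: cst_continuous.
  move=> i z; exact: derivable_cst.
split.
  apply/asboolP; split => //.
  suff -> : supp (0 : R * R -> R) = set0 by exact: compact0.
  rewrite /supp -[RHS]closure0; congr closure.
  by apply/seteqP; split => z //=; rewrite eqxx.
move=> a f g /asboolP[sf kf] /asboolP[sg kg]; apply/asboolP; split; last first.
  apply: (subclosed_compact _ (compactU kf kg) (@supp_lin f g a)).
  exact: closed_closure.
move=> w; rewrite pders_lin//; have [cf df] := sf w; have [cg dg] := sg w.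
split.
  by move=> z; apply: cvgD; [apply: cvgZr; exact: cf|exact: cg].
move=> i z; apply: derivableD; last exact: dg.
by apply: derivableZ; exact: df.
Qed.

HB.instance Definition _ :=
  GRing.isSubmodClosed.Build _ _ (@test_pred R) test_submod_closed.
HB.instance Definition _ := [SubChoice_isSubLmodule of testfun R by <:].

Lemma test_smooth (phi : testfun R) : smooth phi.
Proof. by have /asboolP[] := test_valP phi. Qed.

Lemma test_compact (phi : testfun R) : compact (supp phi).
Proof. by have /asboolP[] := test_valP phi. Qed.

Lemma pdersS w i f : pders w (pder i f) = pders (rcons w i) f.
Proof. by rewrite /pders foldr_rcons. Qed.

Lemma line_coord i (z : R * R) : line i z (coord i z) = z.
Proof. by case: i z => -[]. Qed.

Lemma line_continuous i (z : R * R) : continuous (line i z).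
Proof.
case: i => t.
  exact: (cvg_pair (cvg_cst z.1) (cvg_id (F := nbhs t))).
exact: (cvg_pair (cvg_id (F := nbhs t)) (cvg_cst z.2)).
Qed.

Lemma pder_supp i f : supp (pder i f) `<=` supp f.
Proof.
rewrite [X in _ `<=` X](closure_id _).1; last exact: closed_closure.
apply: closureS => z /=; apply: contraPP => nz.
apply/negP; rewrite negbK; apply/eqP.
have : nbhs z (~` supp f).
  by apply: open_nbhs_nbhs; split => //; apply/closed_openC/closed_closure.
rewrite -{1}(line_coord i z) => /(line_continuous (i := i) (z := z)) nb.
rewrite /pder derive1E.
rewrite (@near_eq_derive _ _ _ _ (cst 0)); first exact: derive_cst.
near=> t.
have nst : ~ supp f (line i z t) by near: t; exact: nb.
apply/eqP/negPn/negP => ft; apply: nst.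
exact: (@subset_closure _ [set z | f z != 0]).
Unshelve. all: by end_near. Qed.

Lemma test_pder_subproof i (phi : testfun R) : pder i phi \in @test_pred R.
Proof.
apply/asboolP; split; first by move=> w; rewrite pdersS; exact: test_smooth.
apply: (@subclosed_compact _ _ (supp phi)).
- exact: closed_closure.
- exact: test_compact.
- exact: pder_supp.
Qed.

Definition test_pder i (phi : testfun R) : testfun R :=
  TestFun (test_pder_subproof i phi).

Definition test_cvg (u : nat -> testfun R) (phi : testfun R) : Prop :=
  (exists2 K : set (R * R), compact K & forall n, supp (u n) `<=` K) /\
  forall w (e : R), 0 < e -> \forall n \near \oo,
    forall z, `|pders w (u n) z - pders w phi z| < e.

End test_functions.

Definition mu2 (R : realType) :=
  (@lebesgue_measure R \x @lebesgue_measure R)%E.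

Section integrability.
Context (R : realType).
Implicit Types (f g : R * R -> R) (A K : set (R * R)).
Local Notation plane := (measurableTypeR R * measurableTypeR R)%type.

Definition square (M : R) : set plane :=
  `[- M, M]%classic `*` `[- M, M]%classic.

Lemma square_measurable M : measurable (square M).
Proof. by apply: measurableX; exact: measurable_itv. Qed.

Lemma square_finite M : (@mu2 R (square M) < +oo)%E.
Proof.
pose I : set R := `[- M, M]%classic.
have fin : (lebesgue_measure I < +oo)%E.
  by rewrite /I lebesgue_measure_itv; case: ifP => // _; rewrite ltry.
rewrite /mu2 /square product_measure1E; try exact: measurable_itv.
by rewrite lte_mul_pinfty// ge0_fin_numE.
Qed.

Lemma compact_square K : compact K -> exists M, K `<=` square M.
Proof.
move=> /compact_bounded[M [_ /(_ (M + 1))]].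
rewrite ltrDl ltr01 => /(_ isT) KM; exists (M + 1) => z /KM /=.
rewrite prod_normE/= ge_max => /andP[].
by rewrite !ler_norml /square /= !in_itv /=.
Qed.

Lemma square_compact M : compact (square M : set (R * R)).
Proof. by apply: compact_setX; exact: (@segment_compact R). Qed.

Lemma open_measurable2 A : open A -> @measurable _ plane A.
Proof.
move=> oA.
pose box (q : rat * rat * (rat * rat)) : set (R * R) :=
  `]ratr q.1.1, ratr q.1.2[%classic `*` `]ratr q.2.1, ratr q.2.2[%classic.
have -> : A = \bigcup_q (if `[< box q `<=` A >] then box q else set0).
  apply/seteqP; split => [z Az|z [q _]]; last first.
    by case: asboolP => // qA /qA.
  have /nbhs_ballP[e /= e0 zA] : nbhs z A by exact: open_nbhs_nbhs.
  have lt1 (x : R) : x - e < x by rewrite ltrBlDr ltrDl.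
  have lt2 (x : R) : x < x + e by rewrite ltrDl.
  have [a] := rat_in_itvoo (lt1 z.1); rewrite in_itv /= => /andP[a1 a2].
  have [b] := rat_in_itvoo (lt2 z.1); rewrite in_itv /= => /andP[b1 b2].
  have [c] := rat_in_itvoo (lt1 z.2); rewrite in_itv /= => /andP[c1 c2].
  have [d] := rat_in_itvoo (lt2 z.2); rewrite in_itv /= => /andP[d1 d2].
  exists ((a, b), (c, d)) => //; case: asboolP.
    by move=> _; split; rewrite /= in_itv /= ?a2 ?b1 ?c2 ?d1.
  case=> -[x y] [] /=; rewrite !in_itv /= => /andP[ax xb] /andP[cy yd].
  apply: zA; split; rewrite /= /ball /= ltr_distlC.
    by rewrite (lt_trans a1 ax) (lt_trans xb b2).
  by rewrite (lt_trans c1 cy) (lt_trans yd d2).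
apply: countable_bigcupT_measurable; first exact: countableP.
move=> q; case: ifP => // _; apply: measurableX; exact: measurable_itv.
Qed.

Lemma continuous_measurable2 f : continuous f -> @measurable_fun _ _ plane R setT f.
Proof.
move=> /continuousP cf; apply: (measurability _ (RGenOpens.measurableE R)).
move=> _ [_ [a [b ->] <-]]; rewrite setTI; apply: open_measurable2.
exact/cf/interval_open.
Qed.

Lemma supp_mull f g : supp (fun z => f z * g z) `<=` supp g.
Proof.
apply: closureS => z /=; apply: contra_neq => ->.
by rewrite mulr0.
Qed.

Lemma supp0 f K z : supp f `<=` K -> ~ K z -> f z = 0.
Proof.
move=> fK Kz; apply/eqP/negPn/negP => fz; apply/Kz/fK.
exact: (@subset_closure _ [set z | f z != 0]).
Qed.

Lemma continuous_square_bounded f M : continuous f ->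
  exists C, forall z, square M z -> `|f z| <= C.
Proof.
move=> cf.
have /compact_bounded[C [_ /(_ (C + 1))]] : compact (f @` square M).
  apply: continuous_compact (@square_compact M).
  exact: continuous_subspaceT.
rewrite ltrDl ltr01 => /(_ isT) fC; exists (C + 1) => z Mz.
by apply: fC; exists z.
Qed.

Lemma square_integrable f M : continuous f ->
  (@mu2 R).-integrable (square M) (EFin \o f).
Proof.
move=> cf; apply: measurable_bounded_integrable.
- exact: square_measurable.
- exact: square_finite.
- by apply: measurable_funS (continuous_measurable2 cf).
- have [C fC] := continuous_square_bounded M cf.
  exists C; split; first exact: num_real.
  by move=> x Cx z Mz; apply: le_trans (fC _ Mz) _; exact: ltW.
Qed.

Lemma restrict_square f M : supp f `<=` square M -> f \_ (square M) = f.
Proof.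
move=> fM; apply/funext => z; rewrite patchE; case: ifPn => //.
by rewrite notin_setE => nM; rewrite (supp0 fM nM).
Qed.

Lemma compact_supp_integrable f : continuous f -> compact (supp f) ->
  (@mu2 R).-integrable setT (EFin \o f).
Proof.
move=> cf /compact_square[M fM].
have := (@integrable_mkcond _ plane R (@mu2 R) _ (EFin \o f)
  (square_measurable M)).1
  (square_integrable M cf).
by rewrite restrict_EFin restrict_square.
Qed.

Lemma Rintegral_square f M : supp f `<=` square M ->
  \int[@mu2 R]_z f z = \int[@mu2 R]_(z in square M) f z.
Proof. by move=> fM; rewrite [RHS]Rintegral_mkcond restrict_square. Qed.

End integrability.

(* On the space of test functions, a linear functional is continuous if and
   only if it is sequentially continuous. *)
Definition dist_pred (R : realType) : {pred testfun R -> R} :=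
  fun T => `[< scalar T /\
    forall u phi, test_cvg u phi -> T (u n) @[n --> \oo] --> T phi >].

Record distribution (R : realType) := Distribution {
  dist_val :> testfun R -> R ;
  dist_valP : dist_val \in @dist_pred R }.

HB.instance Definition _ (R : realType) := [isSub for @dist_val R].
HB.instance Definition _ (R : realType) := [Choice of distribution R by <:].

Section distributions.
Context (R : realType).
Implicit Types (T : distribution R) (phi : testfun R) (i : bool).

Lemma dist_submod_closed : submod_closed (@dist_pred R).
Proof.
split.
  apply/asboolP; split; last by move=> u phi _; exact: cvg_cst.
  by move=> a phi psi; rewrite /= mulr0 addr0.
move=> a S T /asboolP[lS cS] /asboolP[lT cT]; apply/asboolP; split.
  move=> b phi psi.
  have E x : (a *: S + T) x = a * S x + T x by [].
  by rewrite !E lS lT; ring.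
by move=> u phi uphi; apply: cvgD; [apply: cvgZr; exact: cS|exact: cT].
Qed.

HB.instance Definition _ :=
  GRing.isSubmodClosed.Build _ _ (@dist_pred R) dist_submod_closed.
HB.instance Definition _ := [SubChoice_isSubLmodule of distribution R by <:].

Lemma dist_lin T : scalar T.
Proof. by have /asboolP[] := dist_valP T. Qed.

Lemma dist_cvg T u phi : test_cvg u phi -> T (u n) @[n --> \oo] --> T phi.
Proof. by have /asboolP[_] := dist_valP T; exact. Qed.

Lemma test_pder_lin i (a : R) phi psi :
  test_pder i (a *: phi + psi) = a *: test_pder i phi + test_pder i psi.
Proof.
apply: val_inj => /=.
have := pders_lin [:: i] a (test_smooth phi) (test_smooth psi).
by [].
Qed.

Lemma test_pder_cvg i u phi : test_cvg u phi ->
  test_cvg (fun n => test_pder i (u n)) (test_pder i phi).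
Proof.
move=> [[K cK uK] ucvg]; split.
  exists K => // n; apply: subset_trans (uK n); exact: pder_supp.
move=> w e /(ucvg (rcons w i)); apply: filterS => n un z.
by rewrite /= !pdersS; exact: un.
Qed.

Lemma dist_der_subproof i T :
  (fun phi => - T (test_pder i phi)) \in @dist_pred R.
Proof.
apply/asboolP; split.
  by move=> a phi psi /=; rewrite test_pder_lin dist_lin; ring.
by move=> u phi /(test_pder_cvg i)/(@dist_cvg T); exact: cvgN.
Qed.

Definition dist_der i T : distribution R := Distribution (dist_der_subproof i T).

Definition regular_fun (f : R * R -> R) phi : R :=
  \int[@mu2 R]_z (f z * phi z).

Lemma test_continuous phi : continuous phi.
Proof. by have [] := test_smooth phi [::]. Qed.

Lemma regular_integrable (f : R * R -> R) phi : continuous f ->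
  (@mu2 R).-integrable setT (EFin \o (fun z => f z * phi z)).
Proof.
move=> cf; apply: compact_supp_integrable.
  move=> z; apply: cvgM; first exact: cf.
  exact: test_continuous.
apply: (@subclosed_compact _ _ (supp phi)).
- exact: closed_closure.
- exact: test_compact.
- exact: supp_mull.
Qed.

Lemma regular_lin (f : R * R -> R) : continuous f -> scalar (regular_fun f).
Proof.
move=> cf a phi psi; rewrite /regular_fun.
rewrite -RintegralZl//; last exact: regular_integrable.
rewrite -RintegralD//; last exact: regular_integrable.
  by apply: eq_Rintegral => z _ /=; rewrite mulrDr mulrCA.
rewrite [X in EFin \o X](_ : _ = (fun z => f z * (a *: phi) z)).
  exact: regular_integrable.
by apply/funext => z; rewrite mulrCA.
Qed.

Lemma regular_cvg (f : R * R -> R) u phi : continuous f -> test_cvg u phi ->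
  regular_fun f (u n) @[n --> \oo] --> regular_fun f phi.
Proof.
move=> cf [[K cK uK] /(_ [::])/= ucvg].
have [M KM] := compact_square (compactU cK (@test_compact R phi)).
have [C fC] := continuous_square_bounded M cf.
have C1 : 0 < `|C| + 1 by rewrite ltr_wpDl.
pose m := fine (@mu2 R (square M)).
have m0 : 0 < m + 1 by rewrite ltr_wpDl// fine_ge0.
apply/cvgrPdist_lt => e e0.
pose d := e / ((`|C| + 1) * (m + 1)).
have d0 : 0 < d by rewrite divr_gt0// mulr_gt0.
near=> n.
have un z : `|u n z - phi z| < d by move: z; near: n; exact: ucvg.
rewrite distrC.
have -> : regular_fun f (u n) - regular_fun f phi = regular_fun f (u n - phi).
  have := regular_lin cf (- 1) phi (u n).
  by rewrite scaleN1r /= mulN1r => E; rewrite [u n - phi]addrC E addrC.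
rewrite /regular_fun.
have sub : supp (fun z => f z * (u n - phi) z) `<=` square M.
  apply: subset_trans (@supp_mull R f (u n - phi)) _.
  apply: subset_trans KM; rewrite addrC -scaleN1r.
  apply: subset_trans (@supp_lin R phi (u n) (- 1)) _.
  by move=> z [?|/uK ?]; [right|left].
have cg : continuous (fun z => f z * (u n - phi) z).
  move=> z; apply: cvgM; first exact: cf.
  exact: test_continuous.
rewrite (Rintegral_square sub).
have mM := @square_measurable R M.
apply: le_lt_trans (le_normr_Rintegral mM (square_integrable M cg)) _.
apply: (@le_lt_trans _ _ (\int[@mu2 R]_(z in square M) ((`|C| + 1) * d))).
  apply: le_Rintegral => //.
  - by have /integrable_norm := square_integrable M cg.
  - by apply: (@square_integrable R (cst _)); exact: cst_continuous.
  move=> z Mz /=; rewrite normrM ler_pM//.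
    by apply: le_trans (fC _ Mz) _; rewrite (le_trans (ler_norm _))// lerDl.
  exact: ltW (un z).
rewrite Rintegral_cst// -/m /d.
have -> : (`|C| + 1) * (e / ((`|C| + 1) * (m + 1))) * m = e * (m / (m + 1)).
  by field; rewrite !gt_eqF.
by rewrite gtr_pMr// ltr_pdivrMr// mul1r ltrDl.
Unshelve. all: by end_near. Qed.

Definition regular (f : R * R -> R) (cf : continuous f) : distribution R.
Proof.
apply: (@Distribution R (regular_fun f)).
by apply/asboolP; split; [exact: regular_lin|move=> u phi; exact: regular_cvg].
Defined.

End distributions.

Definition Bc_pred (R : realType) : {pred \bar R * \bar R -> R} :=
  fun F => `[< continuous F /\
    forall s : \bar R, F (-oo%E, s) = 0 /\ F (s, -oo%E) = 0 >].

Record Bc (R : realType) := BcFun {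
  Bc_val :> \bar R * \bar R -> R ;
  Bc_valP : Bc_val \in @Bc_pred R }.

HB.instance Definition _ (R : realType) := [isSub for @Bc_val R].
HB.instance Definition _ (R : realType) := [Choice of Bc R by <:].

Section primitives.
Context (R : realType).
Implicit Types (F G : Bc R).

Lemma Bc_submod_closed : submod_closed (@Bc_pred R).
Proof.
split; first by apply/asboolP; split => //; exact: cst_continuous.
move=> a F G /asboolP[cF F0] /asboolP[cG G0]; apply/asboolP; split.
  by move=> z; apply: cvgD; [apply: cvgZr; exact: cF|exact: cG].
move=> s; have [F1 F2] := F0 s; have [G1 G2] := G0 s.
have E z : (a *: F + G) z = a * F z + G z by [].
by rewrite !E F1 F2 G1 G2 mulr0 addr0.
Qed.

HB.instance Definition _ :=
  GRing.isSubmodClosed.Build _ _ (@Bc_pred R) Bc_submod_closed.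
HB.instance Definition _ := [SubChoice_isSubLmodule of Bc R by <:].

Lemma Bc_continuous F : continuous F.
Proof. by have /asboolP[] := Bc_valP F. Qed.

Lemma Bc_mul_subproof F G : (fun z => F z * G z) \in @Bc_pred R.
Proof.
have /asboolP[cF F0] := Bc_valP F; have /asboolP[cG _] := Bc_valP G.
apply/asboolP; split; first by move=> z; apply: cvgM; [exact: cF|exact: cG].
by move=> s; have [-> ->] := F0 s; rewrite !mul0r.
Qed.

Definition Bc_mul F G : Bc R := BcFun (Bc_mul_subproof F G).

Definition sup_norm F : R := sup (range (fun z => `|F z|)).

Definition on_plane F (z : R * R) : R := F (z.1%:E, z.2%:E).

Lemma on_plane_continuous F : continuous (on_plane F).
Proof.
move=> z; apply: (@continuous_comp _ _ _ (fun z : R * R => (z.1%:E, z.2%:E)) F).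
  have EFin_cvg (r : R) : t%:E @[t --> r] --> r%:E by [].
  have h1 : z'.1%:E @[z' --> z] --> z.1%:E.
    exact: (cvg_comp _ _ (@cvg_fst _ _ _ _ _) (EFin_cvg z.1)).
  have h2 : z'.2%:E @[z' --> z] --> z.2%:E.
    exact: (cvg_comp _ _ (@cvg_snd _ _ _ _ _) (EFin_cvg z.2)).
  exact: (cvg_pair h1 h2).
exact: Bc_continuous.
Qed.

(* The second variable is differentiated first: [der12] is d_1 d_2. *)
Definition der12 F : distribution R :=
  dist_der false (dist_der true (regular (@on_plane_continuous F))).

Lemma der12E F phi :
  der12 F phi = regular_fun (on_plane F) (test_pder true (test_pder false phi)).
Proof. exact: opprK. Qed.

Lemma regular_fun_linl (a : R) (f g : R * R -> R) phi :
    continuous f -> continuous g ->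
  regular_fun (fun z => a * f z + g z) phi =
  a * regular_fun f phi + regular_fun g phi.
Proof.
move=> cf cg; rewrite /regular_fun.
rewrite -RintegralZl//; last exact: regular_integrable.
rewrite -RintegralD//; last exact: regular_integrable.
  by apply: eq_Rintegral => z _ /=; rewrite mulrDl mulrA.
rewrite [X in EFin \o X](_ : _ = (fun z => f z * (a *: phi) z)).
  exact: regular_integrable.
by apply/funext => z; rewrite mulrCA.
Qed.

Lemma der12_lin (a : R) F G : der12 (a *: F + G) = a *: der12 F + der12 G.
Proof.
apply: val_inj; apply/funext => phi.
have -> : val (a *: der12 F + der12 G) phi = a * der12 F phi + der12 G phi.
  by [].
have -> : val (der12 (a *: F + G)) phi = der12 (a *: F + G) phi by [].
rewrite !der12E -regular_fun_linl//; exact: on_plane_continuous.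
Qed.

End primitives.

Definition Ac_pred (R : realType) : {pred distribution R} :=
  fun T => `[< exists F : Bc R, der12 F = T >].

Record Ac (R : realType) := AcDist {
  Ac_val :> distribution R ;
  Ac_valP : Ac_val \in @Ac_pred R }.

HB.instance Definition _ (R : realType) := [isSub for @Ac_val R].
HB.instance Definition _ (R : realType) := [Choice of Ac R by <:].

Section integrable_distributions.
Context (R : realType).
Implicit Types (f g : Ac R).

Lemma Ac_submod_closed : submod_closed (@Ac_pred R).
Proof.
split.
  apply/asboolP; exists 0.
  by have := der12_lin (- 1) (0 : Bc R) 0; rewrite !scaleN1r !addNr.
move=> a S T /asboolP[F <-] /asboolP[G <-]; apply/asboolP.
by exists (a *: F + G); rewrite der12_lin.
Qed.

HB.instance Definition _ :=
  GRing.isSubmodClosed.Build _ _ (@Ac_pred R) Ac_submod_closed.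
HB.instance Definition _ := [SubChoice_isSubLmodule of Ac R by <:].

Lemma Ac_der12_subproof (F : Bc R) : der12 F \in @Ac_pred R.
Proof. by apply/asboolP; exists F. Qed.

Definition Ac_der12 (F : Bc R) : Ac R := AcDist (Ac_der12_subproof F).

Lemma primitive_subproof f : exists F : Bc R, Ac_der12 F = f.
Proof.
by have /asboolP[F Ff] := Ac_valP f; exists F; apply: val_inj.
Qed.

(* The primitive of [f] is unique, so this choice is the primitive. *)
Definition primitive f : Bc R := projT1 (cid (primitive_subproof f)).

Definition Ac_mul f g : Ac R := Ac_der12 (Bc_mul (primitive f) (primitive g)).

Definition alexiewicz_norm f : R := sup_norm (primitive f).

End integrable_distributions.

(* No unit is required. *)
Record comm_banach_algebra (R : realType) (V : lmodType R)
    (nrm : V -> R) (mul : V -> V -> V) : Prop := CommBanachAlgebra {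
  cba_norm_ge0 : forall v, 0 <= nrm v ;
  cba_norm_eq0 : forall v, nrm v = 0 -> v = 0 ;
  cba_normZ : forall (a : R) v, nrm (a *: v) = `|a| * nrm v ;
  cba_normD : forall u v, nrm (u + v) <= nrm u + nrm v ;
  cba_complete : forall u : nat -> V,
    (forall e : R, 0 < e -> exists N, forall m n, (N <= m)%N -> (N <= n)%N ->
      nrm (u m - u n) < e) ->
    exists v, nrm (u n - v) @[n --> \oo] --> 0 ;
  cba_mull : forall (a : R) u v w, mul (a *: u + v) w = a *: mul u w + mul v w ;
  cba_mulr : forall (a : R) u v w, mul w (a *: u + v) = a *: mul w u + mul w v ;
  cba_mulA : associative mul ;
  cba_mulC : commutative mul ;
  cba_normM : forall u v, nrm (mul u v) <= nrm u * nrm v }.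

Definition has_unit (V : Type) (mul : V -> V -> V) : Prop :=
  exists e : V, left_id e mul /\ right_id e mul.

Definition has_approximate_identity (R : realType) (V : lmodType R)
    (nrm : V -> R) (mul : V -> V -> V) : Prop :=
  exists u : nat -> V, forall v : V, nrm (v - mul (u n) v) @[n --> \oo] --> 0.

Definition banach_algebra_isomorphic (R : realType) (V W : lmodType R)
    (nrmV : V -> R) (mulV : V -> V -> V)
    (nrmW : W -> R) (mulW : W -> W -> W) : Prop :=
  exists h : {linear V -> W}, [/\ bijective h,
    forall u v, h (mulV u v) = mulW (h u) (h v) &
    forall v, nrmW (h v) = nrmV v].

(* Main.v *)
Require Import Defs.
From HB Require Import structures.
From mathcomp Require Import all_boot all_order all_algebra.
From mathcomp Require Import all_classical all_reals all_analysis.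
From mathcomp Require Import measurable_realfun ring lra.

(** Everything follows once the map sending a primitive F to its mixed
    derivative d_1 d_2 F is known to be injective.  It then becomes a linear
    bijection from B_c onto A_c, and since the product and the norm of A_c are
    defined through primitives, it is an isometric isomorphism of algebras by
    construction.  The Banach algebra axioms, the absence of a unit and the
    approximate identity are therefore statements about B_c, proved there and
    carried over by the three [transport] lemmas.

    In B_c, compactness of the extended plane ([ereal2_compact]) makes the sup
    norm finite, and completeness is the fact that a uniform limit of continuous
    functions is continuous.  The function w(x, y) = (1 + c(x)) (1 + c(y)), with
    c the order isomorphism of the extended line onto [-1, 1], belongs to B_c
    and vanishes only where every element of B_c must vanish.  A unit E would
    satisfy E w = w, so E would be 1 on the whole plane while being 0 on its
    lower and left boundary, against continuity.  The functions min(1, n w) form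
    an approximate identity: w is bounded below by a positive constant on the
    compact set where |F| is at least a given e, so for large n the function
    min(1, n w) equals 1 there, and elsewhere F - min(1, n w) F is smaller
    than e.

    For injectivity ([der12_inj]), let d_1 d_2 F = 0.  Test it against
    a(x) b(y), where a is a plateau rising near a point far to the left and
    falling near x0, and b likewise in the other variable.  The derivative of a
    is a difference of two nonnegative pulses of integral 1, so the equation
    says that an alternating sum of four local averages of F vanishes.  The averages
    are taken near (x0, y0) and near points arbitrarily close to the boundary at
    minus infinity; the latter three are small because F is continuous and zero
    there.  Hence the average near (x0, y0) is small too, and F(x0, y0) = 0.

    Smooth plateaus come from the classical function exp(-1/t), extended by 0 to
    t <= 0.  Smoothness is obtained from a class of functions ([elementary]),
    closed under differentiation by inspection of its generators. *)

Set Implicit Arguments.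
Unset Strict Implicit.
Unset Printing Implicit Defensive.

Import Order.TTheory GRing.Theory Num.Theory.
Import numFieldNormedType.Exports.

Local Open Scope classical_set_scope.
Local Open Scope ring_scope.

(** * Compactness of the extended plane *)

Section extended_plane.
Context (R : realType).

(** The metric of the extended line is pulled back along [contract], which is
    therefore an isometry. *)
Lemma contract_continuous : continuous (@contract R : \bar R -> R).
Proof.
move=> x; apply/cvgrPdist_lt => e e0; near=> y.
suff : ball x e y by [].
near: y; exact: (@nbhsx_ballx R (\bar R) x e e0).
Unshelve. all: by end_near. Qed.

(** The extended line is the isometric image of [-1, 1] under [expand]. *)
Lemma ereal_compact : compact [set: \bar R].
Proof.
have -> : [set: \bar R] = @expand R @` `[- 1, 1]%classic.
  apply/seteqP; split => // x _; exists (contract x); last exact: contractK.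
  by rewrite /= in_itv /= -ler_norml contract_le1.
apply: continuous_compact (@segment_compact R _ _).
apply/subspace_continuousP => r r1; apply/cvg_ballP => e e0.
have unit (t : R) : `[- 1, 1]%classic t -> t \in [pred x : R | `|x| <= 1].
  by rewrite /= in_itv /= inE ler_norml.
rewrite near_withinE; near=> s => s1.
rewrite /ball /= /ereal_ball !expandK; [|exact: unit..].
near: s; exact: (@nbhsx_ballx R R r e e0).
Unshelve. all: by end_near. Qed.

Lemma ereal2_compact : compact [set: \bar R * \bar R].
Proof.
by rewrite -setXTT; exact: compact_setX ereal_compact ereal_compact.
Qed.

(** Gives the uniform positive lower bound on which the approximate identity
    rests. *)
Lemma ereal2_pos_min (f : \bar R * \bar R -> R) : continuous f ->
  (forall z, 0 < f z) -> exists2 d, 0 < d & forall z, d <= f z.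
Proof.
move=> cf f0.
have [|c _ fc] := compact_EVT_min _ ereal2_compact (continuous_subspaceT cf).
  by exists (0, 0)%E.
by exists (f c) => // z; apply: fc; rewrite inE.
Qed.

End extended_plane.

(** * The Banach algebra of primitives *)

Section primitive_algebra.
Context (R : realType).
Implicit Types (F G H : Bc R).

Lemma Bc_ext F G : F =1 G -> F = G.
Proof. by move=> FG; apply/val_inj/funext. Qed.

Lemma BcE (a : R) F G z : (a *: F + G) z = a * F z + G z.
Proof. by []. Qed.

Lemma BcZE (a : R) F z : (a *: F) z = a * F z.
Proof. by []. Qed.

Lemma BcDE F G z : (F + G) z = F z + G z.
Proof. by []. Qed.

Lemma BcBE F G z : (F - G) z = F z - G z.
Proof. by []. Qed.

Lemma Bc_mulE F G z : Bc_mul F G z = F z * G z.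
Proof. by []. Qed.

Lemma Bc_boundary F s : F (-oo%E, s) = 0 /\ F (s, -oo%E) = 0.
Proof. by have /asboolP[_] := Bc_valP F. Qed.

Lemma sup_norm_ub F z : `|F z| <= sup_norm F.
Proof.
apply: (@ub_le_sup R); last by exists z.
have [||c _ Fc] :=
  compact_EVT_max (f := fun z => `|F z|) _ (@ereal2_compact R) _.
- by exists (0, 0)%E.
- apply: continuous_subspaceT => x; apply: cvg_norm; exact: Bc_continuous.
by exists `|F c| => _ [y _ <-]; apply: Fc; rewrite inE.
Qed.

Lemma sup_norm_le F (C : R) : (forall z, `|F z| <= C) -> sup_norm F <= C.
Proof.
move=> FC; apply: ge_sup; first by exists `|F (0, 0)%E|; exists (0, 0)%E.
by move=> _ [z _ <-].
Qed.

Lemma sup_norm_ge0 F : 0 <= sup_norm F.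
Proof. exact: le_trans (normr_ge0 _) (sup_norm_ub F (0, 0)%E). Qed.

Lemma sup_norm_eq0 F : sup_norm F = 0 -> F = 0.
Proof.
move=> F0; apply: Bc_ext => z; apply/eqP.
by rewrite -normr_le0 -F0 sup_norm_ub.
Qed.

Lemma sup_normZ_le (a : R) F : sup_norm (a *: F) <= `|a| * sup_norm F.
Proof.
by apply: sup_norm_le => z; rewrite BcZE normrM ler_wpM2l// sup_norm_ub.
Qed.

(** The inequality [sup_normZ_le], applied to [a] and to its inverse. *)
Lemma sup_normZ (a : R) F : sup_norm (a *: F) = `|a| * sup_norm F.
Proof.
apply/eqP; rewrite eq_le sup_normZ_le /=.
have [->|a0] := eqVneq a 0; first by rewrite normr0 mul0r sup_norm_ge0.
rewrite mulrC -ler_pdivlMr ?normr_gt0// mulrC -normfV.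
by have := sup_normZ_le a^-1 (a *: F); rewrite scalerA mulVf// scale1r.
Qed.

Lemma sup_normD F G : sup_norm (F + G) <= sup_norm F + sup_norm G.
Proof.
apply: sup_norm_le => z.
by rewrite BcDE (le_trans (ler_normD _ _))// lerD// sup_norm_ub.
Qed.

Lemma sup_normM F G : sup_norm (Bc_mul F G) <= sup_norm F * sup_norm G.
Proof.
by apply: sup_norm_le => z; rewrite Bc_mulE normrM ler_pM// sup_norm_ub.
Qed.

Lemma Bc_complete (u : nat -> Bc R) :
  (forall e : R, 0 < e -> exists N, forall m n, (N <= m)%N -> (N <= n)%N ->
    sup_norm (u m - u n) < e) ->
  exists F, sup_norm (u n - F) @[n --> \oo] --> 0.
Proof.
move=> uC.
have ucv z : cvg (u n z @[n --> \oo]).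
  apply: cauchy_cvg; apply: cauchy_exP => e /uC[N uN].
  exists (u N z); exists N => // n /= Nn; rewrite /ball /= -BcBE.
  exact: le_lt_trans (sup_norm_ub _ _) (uN _ _ (leqnn _) Nn).
pose l z := lim (u n z @[n --> \oo]).
(* The Cauchy estimate passes to the limit in its second index, which makes
   the pointwise convergence uniform. *)
have ul (e : R) : 0 < e ->
    exists N, forall n z, (N <= n)%N -> `|u n z - l z| <= e.
  move=> /uC[N uN]; exists N => n z Nn.
  have cvl : `|u n z - u m z| @[m --> \oo] --> `|u n z - l z|.
    by apply: cvg_norm; apply: cvgB (ucv z); exact: cvg_cst.
  rewrite -(cvg_lim _ cvl)//; apply: limr_le.
    by apply/cvg_ex; exists `|u n z - l z|.
  near=> m; rewrite -BcBE; apply: le_trans (sup_norm_ub _ _) (ltW _).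
  by apply: uN => //; near: m; exists N.
have lB : l \in @Bc_pred R.
  apply/asboolP; split; last first.
    move=> s; rewrite /l; split.
      under eq_fun do rewrite (Bc_boundary _ s).1.
      exact: lim_cst.
    under eq_fun do rewrite (Bc_boundary _ s).2.
    exact: lim_cst.
  move=> z; apply/cvgrPdist_lt => e e0.
  have [|N uN] := ul (e / 3); first by rewrite divr_gt0.
  near=> y.
  have h1 := uN N z (leqnn N); have h2 := uN N y (leqnn N).
  have h3 : `|u N z - u N y| < e / 3.
    near: y; move/cvgrPdist_lt : (@Bc_continuous R (u N) z); apply.
    by rewrite divr_gt0.
  have -> : l z - l y = (u N z - u N y) - (u N z - l z) + (u N y - l y) by ring.
  apply: le_lt_trans (ler_normD _ _) _.
  apply: le_lt_trans (lerD (ler_normB _ _) (lexx _)) _.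
  lra.
exists (BcFun lB); apply/cvgrPdist_le => e /ul[N uN].
near=> n; rewrite sub0r normrN ger0_norm ?sup_norm_ge0//.
by apply: sup_norm_le => z; rewrite BcBE; apply: uN; near: n; exists N.
Unshelve. all: by end_near. Qed.

Lemma Bc_comm_banach_algebra : comm_banach_algebra (@sup_norm R) (@Bc_mul R).
Proof.
split.
- exact: sup_norm_ge0.
- exact: sup_norm_eq0.
- exact: sup_normZ.
- exact: sup_normD.
- exact: Bc_complete.
- by move=> a F G H; apply: Bc_ext => z; rewrite !(Bc_mulE, BcE); ring.
- by move=> a F G H; apply: Bc_ext => z; rewrite !(Bc_mulE, BcE); ring.
- by move=> F G H; apply: Bc_ext => z; rewrite !Bc_mulE mulrA.
- by move=> F G; apply: Bc_ext => z; rewrite !Bc_mulE mulrC.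
- exact: sup_normM.
Qed.

(** A continuous function whose only zeros are the boundary points where every
    element of [Bc R] vanishes. *)
Definition weight (z : \bar R * \bar R) : R :=
  (1 + contract z.1) * (1 + contract z.2).

Lemma weight_continuous : continuous weight.
Proof.
move=> z; apply: cvgM; (apply: cvgD; first exact: cvg_cst).
  apply: (@cvg_comp _ _ _ fst (@contract R)); first exact: cvg_fst.
  exact: contract_continuous.
apply: (@cvg_comp _ _ _ snd (@contract R)); first exact: cvg_snd.
exact: contract_continuous.
Qed.

Lemma contract1_gt0 (x : \bar R) : x != -oo%E -> 0 < 1 + contract x.
Proof.
rewrite -contract_eqN1 => xN1; rewrite -ltrBlDl sub0r lt_neqAle eq_sym xN1.
by have := contract_le1 x; rewrite ler_norml => /andP[].
Qed.

Lemma weight_ge0 z : 0 <= weight z.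
Proof.
have h (x : \bar R) : 0 <= 1 + contract x.
  rewrite -lerBlDl sub0r; have := contract_le1 x.
  by rewrite ler_norml => /andP[].
by rewrite /weight mulr_ge0.
Qed.

Lemma weight_gt0 z : z.1 != -oo%E -> z.2 != -oo%E -> 0 < weight z.
Proof. by move=> z1 z2; rewrite /weight mulr_gt0// contract1_gt0. Qed.

Lemma weight_boundary s : weight (-oo%E, s) = 0 /\ weight (s, -oo%E) = 0.
Proof. by rewrite /weight /= subrr mul0r mulr0. Qed.

Lemma weight_Bc_subproof : weight \in @Bc_pred R.
Proof.
by apply/asboolP; split; [exact: weight_continuous|exact: weight_boundary].
Qed.

Definition weight_Bc : Bc R := BcFun weight_Bc_subproof.

(** A unit would be 1 wherever [weight] is nonzero, in particular along the
    real line y = 0, yet 0 at the left end of that line. *)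
Lemma Bc_no_unit : ~ has_unit (@Bc_mul R).
Proof.
case=> E [El _].
have E1 (x : R) : E (x%:E, 0%E) = 1.
  have : E (x%:E, 0%E) * weight (x%:E, 0%E) = weight (x%:E, 0%E).
    by have /(congr1 (fun F : Bc R => F (x%:E, 0%E))) := El weight_Bc.
  by move=> /(canRL (mulfK _)) ->; rewrite ?divff// gt_eqF// weight_gt0.
have /cvgrPdist_lt/(_ 1 ltr01) := @Bc_continuous R E (-oo%E, 0%E).
rewrite (Bc_boundary E 0%E).1 => -[[A B] /= [[M [_ AM]] B0] AB].
have : (A `*` B) ((M - 1)%:E, 0%E).
  split => /=; last exact: nbhs_singleton.
  by apply: AM; rewrite lte_fin ltrBlDr ltrDl.
by move=> /AB /=; rewrite E1 sub0r normrN normr1 ltxx.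
Qed.

Definition cutoff (n : nat) (z : \bar R * \bar R) : R :=
  Num.min 1 (n%:R * weight z).

Lemma cutoff_Bc_subproof n : cutoff n \in @Bc_pred R.
Proof.
apply/asboolP; split; last first.
  move=> s; have [w1 w2] := weight_boundary s.
  by rewrite /cutoff w1 w2 mulr0 min_r.
move=> z; apply: (@continuous_min R _ (cst 1) (fun z => n%:R * weight z)).
  exact: cst_continuous.
apply: cvgM; [exact: cvg_cst|exact: weight_continuous].
Qed.

Definition cutoff_Bc n : Bc R := BcFun (cutoff_Bc_subproof n).

Lemma Bc_approximate_identity :
  has_approximate_identity (@sup_norm R) (@Bc_mul R).
Proof.
exists cutoff_Bc => F; apply/cvgrPdist_le => e e0.
(* [p] is positive everywhere: off the boundary because of [weight], on it
   because [F] vanishes.  A lower bound of [p] bounds [weight] from below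
   wherever [`|F|] is at least [e]. *)
pose p z := Num.max (weight z) (e - `|F z|).
have cp : continuous p.
  move=> z; apply: continuous_max; first exact: weight_continuous.
  apply: cvgB; first exact: cvg_cst.
  by apply: cvg_norm; exact: Bc_continuous.
have p0 z : 0 < p z.
  rewrite /p lt_max; apply/orP.
  have [z1|z1] := eqVneq z.1 -oo%E.
    by right; rewrite (surjective_pairing z) z1 (Bc_boundary F _).1 normr0 subr0.
  have [z2|z2] := eqVneq z.2 -oo%E.
    by right; rewrite (surjective_pairing z) z2 (Bc_boundary F _).2 normr0 subr0.
  by left; exact: weight_gt0.
have [d d0 pd] := ereal2_pos_min cp p0.
near=> n; rewrite sub0r normrN ger0_norm ?sup_norm_ge0//.
apply: sup_norm_le => z; rewrite BcBE Bc_mulE.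
have nd : d^-1 <= n%:R by near: n; exact: nbhs_infty_ger.
have -> : F z - cutoff n z * F z = (1 - cutoff n z) * F z by ring.
have c0 : 0 <= cutoff n z by rewrite /cutoff le_min ler01 mulr_ge0// weight_ge0.
have c1 : cutoff n z <= 1 by rewrite /cutoff ge_min lexx.
have [dw|wd] := leP d (weight z).
  suff -> : cutoff n z = 1 by rewrite subrr mul0r normr0 ltW.
  rewrite /cutoff min_l//; apply: (@le_trans _ _ (d^-1 * d)).
    by rewrite mulVf// lt0r_neq0.
  by rewrite ler_pM// ?invr_ge0 ltW.
have : d <= p z by exact: pd.
rewrite /p le_max leNgt wd /= => dF.
rewrite normrM (@le_trans _ _ (1 * `|F z|))//.
  by rewrite ler_wpM2r// ger0_norm ?subr_ge0// lerBlDr lerDl.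
by rewrite mul1r; lra.
Unshelve. all: by end_near. Qed.

End primitive_algebra.

(** * Smooth steps on the line *)

Section smooth_step.
Context (R : realType).
Implicit Types (f g : R -> R) (x t : R).

(** The family is indexed by the power of 1/t because differentiation acts on
    it: the derivative of t^-k exp(-1/t) combines the members k + 2 and k + 1. *)
Definition flat (k : nat) (t : R) : R :=
  if t <= 0 then 0 else t ^- k * expR (- t^-1).

Lemma flat_le0 k t : t <= 0 -> flat k t = 0.
Proof. by rewrite /flat => ->. Qed.

Lemma flat_pos k t : 0 < t -> flat k t = t ^- k * expR (- t^-1).
Proof. by rewrite /flat leNgt => ->. Qed.

Lemma flat_ge0 k t : 0 <= flat k t.
Proof.
rewrite /flat; case: (leP t 0) => // t0.
by rewrite mulr_ge0 ?expR_ge0// invr_ge0 exprn_ge0// ltW.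
Qed.

Lemma flat_gt0 k t : 0 < t -> 0 < flat k t.
Proof.
by move=> t0; rewrite flat_pos// mulr_gt0 ?expR_gt0// invr_gt0 exprn_gt0.
Qed.

(** The exponential series gives exp(1/t) >= t^-(k + 2) / (k + 2)!; the
    quadratic bound is what makes [flat k] differentiable at 0. *)
Lemma flat_bound k t : `|flat k t| <= k.+2`!%:R * t ^+ 2.
Proof.
rewrite ger0_norm ?flat_ge0//; have [t0|t0] := leP t 0.
  by rewrite flat_le0// mulr_ge0// sqr_ge0.
have tV : 0 < t^-1 by rewrite invr_gt0.
rewrite flat_pos// expRN ler_pdivrMr ?expR_gt0//.
have : t ^- k.+2 / k.+2`!%:R <= expR t^-1.
  apply: le_trans (expR_ge1Dxn k.+1 (ltW tV)).
  by rewrite exprVn lerDr.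
have f0 : 0 < k.+2`!%:R :> R by rewrite ltr0n fact_gt0.
have t2 : 0 < t ^+ 2 by rewrite exprn_gt0.
rewrite ler_pdivrMr// => h.
have -> : t ^- k = t ^- k.+2 * t ^+ 2.
  by rewrite -addn2 exprD invfM mulfVK// gt_eqF.
by rewrite mulrAC ler_pM2r// mulrC.
Qed.

Lemma is_derive_sqr_bound f (C : R) : (forall t, `|f t| <= C * t ^+ 2) ->
  is_derive (0 : R) (1 : R) f 0.
Proof.
move=> fC.
have f0 : f 0 = 0.
  apply/normr0_eq0/eqP.
  by rewrite eq_le normr_ge0 (le_trans (fC 0)) ?expr0n ?mulr0.
have C0 : 0 <= C by have := le_trans (normr_ge0 _) (fC 1); rewrite expr1n mulr1.
suff h : h^-1 *: ((f \o shift 0) (h *: 1) - f 0) @[h --> 0^'] --> (0 : R).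
  by apply: DeriveDef; [apply/cvg_ex; exists 0|exact: cvg_lim h].
have C1 : 0 < C + 1 by rewrite ltr_wpDl.
apply/cvgrPdist_le => e e0; near=> h.
have h0 : h != 0 by near: h; exact: nbhs_dnbhs_neq.
rewrite f0 subr0 sub0r normrN /= addr0 [h *: 1]mulr1 normrZ normfV.
rewrite mulrC ler_pdivrMr ?normr_gt0// (le_trans (fC h))//.
rewrite -real_normK ?num_real// expr2 mulrA ler_wpM2r//.
apply: (@le_trans _ _ ((C + 1) * `|h|)); first by rewrite ler_wpM2r// lerDl.
rewrite mulrC -ler_pdivlMr//.
near: h; apply: dnbhs0_le; exact: divr_gt0.
Unshelve. all: by end_near. Qed.

Lemma flat_derive k t :
  is_derive t (1 : R) (flat k) (flat k.+2 t - k%:R * flat k.+1 t).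
Proof.
have [t0|t0|->] := ltgtP t 0.
- rewrite !flat_le0 ?ltW// mulr0 subrr.
  apply: (@near_eq_is_derive _ _ _ (cst 0)).
    near=> s; rewrite flat_le0// ltW//; near: s; exact: lt_nbhsl.
- apply: (@near_eq_is_derive R R R (fun s : R => (s ^+ k)^-1 * expR (- s^-1))).
    near=> s; rewrite flat_pos//; near: s; exact: lt_nbhsr.
  rewrite !flat_pos//.
  have tn0 : t != 0 by rewrite gt_eqF.
  have dV : is_derive t 1 (fun s : R => (s ^+ k)^-1)
      (- (t ^+ k) ^- 2 *: (k%:R *: t ^+ k.-1)).
    apply: is_deriveV; first by rewrite expf_neq0.
    apply: DeriveDef; first exact: exprn_derivable.
    by rewrite exp_derive [_ *: 1]mulr1.
  have dN : is_derive t 1 (fun s : R => - s^-1) (t ^- 2).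
    apply: (is_derive_eq (is_deriveN (is_deriveV tn0 (is_derive_id t 1)))).
    by rewrite /= scaleNr opprK [_ *: 1]mulr1.
  have dE := @is_derive1_comp R expR (fun s => - s^-1) t _ _
    (is_derive_expR (- t^-1)) dN.
  have dM := is_deriveM dV dE.
  apply: (is_derive_eq dM).
  rewrite /= /GRing.scale /=. 
  case: k {dV dE dM} => [|k]; first by rewrite !expr0; field.
  rewrite /= !exprS; field.
  by rewrite tn0 expf_neq0.
- rewrite !flat_le0// mulr0 subrr.
  apply: is_derive_sqr_bound; exact: flat_bound.
Unshelve. all: by end_near. Qed.

Lemma flat_right_derive k p x :
  is_derive x (1 : R) (fun x => flat k (x - p))
    (flat k.+2 (x - p) - k%:R * flat k.+1 (x - p)).
Proof.
have := @is_derive1_comp R (flat k) (shift (- p)) x _ _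
  (flat_derive k (x - p)) (is_derive_shift x 1 (- p)).
by rewrite mulr1.
Qed.

Lemma flat_left_derive k q x :
  is_derive x (1 : R) (fun x => flat k (q - x))
    (- (flat k.+2 (q - x) - k%:R * flat k.+1 (q - x))).
Proof.
have dq : is_derive x (1 : R) (fun x => q - x) (- 1).
  have dB := is_deriveB (is_derive_cst q x 1) (is_derive_id x (1 : R)).
  by apply: (is_derive_eq dB); rewrite sub0r.
have := @is_derive1_comp R (flat k) (fun x => q - x) x _ _
  (flat_derive k (q - x)) dq.
by rewrite mulrN1.
Qed.

(** A set of functions stable under differentiation: each derivative of a member
    is again built by the same rules, so all members are smooth. *)
Inductive elementary : (R -> R) -> Prop :=
| elementary_flat_right k p : elementary (fun x => flat k (x - p))
| elementary_flat_left k q : elementary (fun x => flat k (q - x))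
| elementary_cst c : elementary (fun=> c)
| elementary_add f g : elementary f -> elementary g ->
    elementary (fun x => f x + g x)
| elementary_mul f g : elementary f -> elementary g ->
    elementary (fun x => f x * g x)
| elementary_inv f : (forall x, f x != 0) -> elementary f ->
    elementary (fun x => (f x)^-1).

Lemma elementary_opp f : elementary f -> elementary (fun x => - f x).
Proof.
move=> ef; rewrite (_ : (fun _ => _) = fun x => -1 * f x).
  exact/elementary_mul/ef/elementary_cst.
by apply/funext => x; rewrite mulN1r.
Qed.

Lemma elementary_is_derive f : elementary f ->
  exists2 df, elementary df & forall x, is_derive x (1 : R) f (df x).
Proof.
elim=> {f} [k p|k q|c|f g ef [df edf fd] eg [dg edg gd]|
  f g ef [df edf fd] eg [dg edg gd]|f f0 ef [df edf fd]].
- eexists; last by move=> x; exact: flat_right_derive.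
  apply: (elementary_add (elementary_flat_right _ _)).
  apply/elementary_opp/elementary_mul/elementary_flat_right.
  exact: elementary_cst.
- eexists; last by move=> x; exact: flat_left_derive.
  apply/elementary_opp/(elementary_add (elementary_flat_left _ _)).
  apply/elementary_opp/elementary_mul/elementary_flat_left.
  exact: elementary_cst.
- exists (fun=> 0); first exact: elementary_cst.
  by move=> x; exact: (is_derive_cst c x 1).
- exists (fun x => df x + dg x); first exact: elementary_add.
  by move=> x; exact: is_deriveD.
- exists (fun x => f x * dg x + g x * df x).
    by apply: elementary_add; exact: elementary_mul.
  by move=> x; exact: is_deriveM.
- exists (fun x => - ((f x)^-1 * (f x)^-1 * df x)).
    apply: elementary_opp; apply: elementary_mul edf.
    by apply: elementary_mul; exact: elementary_inv.
  move=> x; apply: (is_derive_eq (is_deriveV (f0 x) (fd x))).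
  by rewrite scaleNr -invfM -expr2.
Qed.

Lemma elementary_derivable f x : elementary f -> derivable f x 1.
Proof. by move=> /elementary_is_derive[df _ /(_ x)/@ex_derive]. Qed.

Lemma elementary_derive1 f : elementary f -> elementary f^`()%classic.
Proof.
move=> /elementary_is_derive[df edf fd].
suff -> : f^`()%classic = df by [].
by apply/funext => x; rewrite derive1E (@derive_val _ _ _ _ _ _ _ (fd x)).
Qed.

Lemma elementary_continuous f : elementary f -> continuous f.
Proof.
move=> ef x; apply: differentiable_continuous; apply/derivable1_diffP.
exact: elementary_derivable.
Qed.

(** The denominator never vanishes when p < q, because then every x
    satisfies x > p or x < q. *)
Definition step_den p q x := flat 0 (x - p) + flat 0 (q - x).

Definition step p q x : R := flat 0 (x - p) / step_den p q x.

(** The derivative of [step p q] for p < q, in a form that shows its sign and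
    its support. *)
Definition pulse p q x : R :=
  (flat 2 (x - p) * flat 0 (q - x) + flat 0 (x - p) * flat 2 (q - x)) /
  step_den p q x ^+ 2.

Section one_step.
Context (p q : R) (pq : p < q).

Lemma step_den_gt0 x : 0 < step_den p q x.
Proof.
have [xp|px] := leP x p.
  by rewrite ltr_wpDl ?flat_ge0// flat_gt0// subr_gt0 (le_lt_trans xp).
by rewrite ltr_pwDl ?flat_ge0// flat_gt0// subr_gt0.
Qed.

Lemma step_le x : x <= p -> step p q x = 0.
Proof. by move=> xp; rewrite /step flat_le0 ?mul0r// subr_le0. Qed.

Lemma step_ge x : q <= x -> step p q x = 1.
Proof.
move=> qx; rewrite /step; have := step_den_gt0 x; rewrite /step_den.
by rewrite (@flat_le0 _ (q - x)) ?subr_le0// addr0 => h; rewrite divff// gt_eqF.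
Qed.

Lemma elementary_step : elementary (step p q).
Proof.
apply: elementary_mul; first exact: elementary_flat_right.
apply: elementary_inv; first by move=> x; rewrite gt_eqF// step_den_gt0.
apply: elementary_add; first exact: elementary_flat_right.
exact: elementary_flat_left.
Qed.

Lemma step_derive1 : (step p q)^`()%classic = pulse p q.
Proof.
apply/funext => x; rewrite derive1E.
have dn0 : step_den p q x != 0 by rewrite gt_eqF// step_den_gt0.
have dD := is_deriveD (flat_right_derive 0 p x) (flat_left_derive 0 q x).
have dV := @is_deriveV R (step_den p q) x _ 1 dn0 dD.
have dM := is_deriveM (flat_right_derive 0 p x) dV.
rewrite (@derive_val _ _ _ _ _ _ _ dM) /pulse /GRing.scale /= !mul0r !subr0.
by move: dn0; rewrite /step_den => dn0; field.
Qed.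

Lemma pulse_ge0 x : 0 <= pulse p q x.
Proof. by rewrite /pulse divr_ge0 ?sqr_ge0// addr_ge0// mulr_ge0// flat_ge0. Qed.

Lemma pulse0 x : ~~ (p < x < q) -> pulse p q x = 0.
Proof.
rewrite negb_and -!leNgt => /orP[xp|qx]; rewrite /pulse.
  by rewrite !(@flat_le0 _ (x - p)) ?subr_le0// !mul0r addr0 mul0r.
by rewrite !(@flat_le0 _ (q - x)) ?subr_le0// !mulr0 addr0 mul0r.
Qed.

Lemma pulse_continuous : continuous (pulse p q).
Proof.
rewrite -step_derive1; apply: elementary_continuous.
exact/elementary_derive1/elementary_step.
Qed.

(** The integral of a derivative: [step p q] goes from 0 to 1 on [p, q]. *)
Lemma pulse_integral : (\int[lebesgue_measure]_x (pulse p q x)%:E = 1)%E.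
Proof.
have -> : (\int[lebesgue_measure]_x (pulse p q x)%:E =
    \int[lebesgue_measure]_(x in `[p, q]) (pulse p q x)%:E)%E.
  rewrite [RHS]integral_mkcond; apply: eq_integral => x _.
  rewrite patchE; case: ifPn => //; rewrite notin_setE /= in_itv /= => xpq.
  rewrite pulse0//; apply: contra_notN xpq => /andP[px xq].
  by rewrite !ltW.
have cs x : step p q y @[y --> x] --> step p q x.
  exact/elementary_continuous/elementary_step.
rewrite (continuous_FTC2 pq (F := step p q)).
- by rewrite step_ge// step_le// sube0.
- exact/continuous_subspaceT/pulse_continuous.
- split; first by move=> x _; exact/elementary_derivable/elementary_step.
  + by apply: cvg_at_right_filter; exact: cs.
  + by apply: cvg_at_left_filter; exact: cs.
- by move=> x _; rewrite step_derive1.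
Qed.

End one_step.

End smooth_step.

(** * Product test functions and local averages *)

Section tensor_products.
Context (R : realType).
Implicit Types (a b : R -> R) (z : R * R).

Definition tensor a b z : R := a z.1 * b z.2.

Lemma tensor_continuous a b : continuous a -> continuous b ->
  continuous (tensor a b).
Proof.
move=> ca cb z; apply: cvgM.
  by apply: (@cvg_comp _ _ _ fst a); [exact: cvg_fst|exact: ca].
by apply: (@cvg_comp _ _ _ snd b); [exact: cvg_snd|exact: cb].
Qed.

Lemma tensor_supp a b (p q r s : R) :
  (forall x, ~~ (p <= x <= q) -> a x = 0) ->
  (forall x, ~~ (r <= x <= s) -> b x = 0) ->
  compact (supp (tensor a b)).
Proof.
move=> a0 b0.
have cpt : compact ((`[p, q] `*` `[r, s])%classic : set (R * R)).
  by apply: compact_setX; exact: (@segment_compact R).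
apply: (subclosed_compact _ cpt); first exact: closed_closure.
rewrite [X in _ `<=` X](closure_id _).1; last first.
  by apply: compact_closed cpt; exact: norm_hausdorff.
apply: closureS => z /=; apply: contraPP => nz; apply/negP; rewrite negbK.
rewrite /tensor; have [/a0 -> |pq] := boolP (~~ (p <= z.1 <= q)).
  by rewrite mul0r.
have [/b0 -> |rs] := boolP (~~ (r <= z.2 <= s)); first by rewrite mulr0.
by case: nz; rewrite negbK in pq; rewrite negbK in rs; split; rewrite /= in_itv.
Qed.

Lemma pder_tensor i a b : elementary a -> elementary b ->
  pder i (tensor a b) =
  if i then tensor a b^`()%classic else tensor a^`()%classic b.
Proof.
move=> ea eb; apply/funext => z; rewrite /pder /tensor; case: i => /=.
  by rewrite derive1Ml//; exact: elementary_derivable.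
by rewrite derive1Mr//; exact: elementary_derivable.
Qed.

(** A mixed derivative of a product a(x) b(y) differentiates each factor
    separately, so smoothness in the plane reduces to one variable. *)
Lemma pders_tensor w a b : elementary a -> elementary b ->
  exists a' b', [/\ elementary a', elementary b' &
    pders w (tensor a b) = tensor a' b'].
Proof.
move=> ea eb; elim: w => /= [|i w [a' [b' [ea' eb' ->]]]]; first by exists a, b.
rewrite pder_tensor//; case: i.
  by exists a', b'^`()%classic; split=> //; exact: elementary_derive1.
by exists a'^`()%classic, b'; split=> //; exact: elementary_derive1.
Qed.

Lemma tensor_smooth a b : elementary a -> elementary b -> smooth (tensor a b).
Proof.
move=> ea eb w; have [a' [b' [ea' eb' ->]]] := pders_tensor w ea eb; split.
  by apply: tensor_continuous; exact: elementary_continuous.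
move=> i z; apply: elementary_derivable; case: i; rewrite /tensor /=.
  by apply: elementary_mul => //; exact: elementary_cst.
by apply: elementary_mul => //; exact: elementary_cst.
Qed.

Lemma pulse_out (p q x : R) : ~~ (p <= x <= q) -> pulse p q x = 0.
Proof.
by move=> h; rewrite pulse0//; apply: contra h => /andP[h1 h2]; rewrite !ltW.
Qed.

Section box.
Context (p q r s : R) (pq : p < q) (rs : r < s).

Lemma box_integral : \int[@mu2 R]_z tensor (pulse p q) (pulse r s) z = 1.
Proof.
rewrite /Rintegral /mu2 fubini_tonelli1.
- rewrite -[RHS]/(fine 1%E) -(pulse_integral pq); congr fine.
  apply: eq_integral => x _; rewrite /fubini_F /tensor /=.
  under eq_integral do rewrite EFinM.
  rewrite ge0_integralZl ?pulse_integral ?mule1 ?lee_fin ?pulse_ge0//.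
  + apply: measurableT_comp => //.
    by apply: (@continuous_measurable_fun R); exact: pulse_continuous.
  + by move=> y _; rewrite lee_fin pulse_ge0.
- apply/measurable_EFinP; apply: continuous_measurable2.
  by apply: tensor_continuous; exact: pulse_continuous.
- by move=> z; rewrite lee_fin mulr_ge0// pulse_ge0.
Qed.

Lemma box_integrable (f : R * R -> R) : continuous f ->
  (@mu2 R).-integrable setT
    (EFin \o (fun z => f z * tensor (pulse p q) (pulse r s) z)).
Proof.
move=> cf; apply: compact_supp_integrable.
  move=> z; apply: cvgM; first exact: cf.
  by apply: tensor_continuous; exact: pulse_continuous.
apply: (subclosed_compact _ (tensor_supp (@pulse_out p q) (@pulse_out r s))).
  exact: closed_closure.
exact: supp_mull.
Qed.

(** The product of two pulses is a probability density on a box: averaging [f]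
    against it gives a value as close to [c] as [f] is on the box. *)
Lemma box_average (f : R * R -> R) (c e : R) : continuous f ->
  (forall x y, p <= x <= q -> r <= y <= s -> `|f (x, y) - c| <= e) ->
  `|\int[@mu2 R]_z (f z * tensor (pulse p q) (pulse r s) z) - c| <= e.
Proof.
move=> cf fc; set u := tensor _ _.
have u0 z : 0 <= u z by rewrite mulr_ge0// pulse_ge0.
have cc (k : R) : continuous (cst k : R * R -> R) by exact: cst_continuous.
have iu k : (@mu2 R).-integrable setT (EFin \o (fun z => k * u z)).
  exact: (box_integrable (cc k)).
have ju k : \int[@mu2 R]_z (k * u z) = k.
  rewrite RintegralZl//; first by rewrite box_integral mulr1.
  have := iu 1; congr (_.-integrable _ _); apply/funext => z /=.
  by rewrite mul1r.
have iF := box_integrable cf.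
rewrite -[X in _ - X](ju c) -RintegralB//.
have cfc : continuous (fun z => f z - c).
  by move=> z; apply: cvgB; [exact: cf|exact: cvg_cst].
have iD := box_integrable cfc.
rewrite (_ : \int[_]_z _ = \int[@mu2 R]_z ((f z - c) * u z)); last first.
  by apply: eq_Rintegral => z _; rewrite mulrBl.
apply: le_trans (le_normr_Rintegral _ iD) _ => //.
rewrite -[leRHS](ju e); apply: le_Rintegral => //.
  by have /integrable_norm := iD.
move=> [x y] _; rewrite normrM (ger0_norm (u0 _)).
have [xpq|xpq] := boolP (p <= x <= q); last first.
  by rewrite /u /tensor /= pulse_out// mul0r !mulr0.
have [yrs|yrs] := boolP (r <= y <= s); last first.
  by rewrite /u /tensor /= (pulse_out yrs) !mulr0.
by rewrite ler_wpM2r// fc.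
Qed.

End box.

(** The test function is a product of two plateaus, each the difference of an
    early step and a late one. *)
Lemma window_test_function (p0 q0 p1 q1 r0 s0 r1 s1 : R) :
  p1 < q1 -> q1 <= p0 -> p0 < q0 -> r1 < s1 -> s1 <= r0 -> r0 < s0 ->
  exists phi : testfun R, test_pder true (test_pder false phi) =1
    tensor (fun x => pulse p1 q1 x - pulse p0 q0 x)
           (fun y => pulse r1 s1 y - pulse r0 s0 y).
Proof.
have window (p q p' q' : R) : p' < q' -> q' <= p -> p < q ->
    exists a, [/\ elementary a,
      forall x, ~~ (p' <= x <= q) -> a x = 0 &
      a^`()%classic = fun x => pulse p' q' x - pulse p q x].
  move=> pq' qp pq; exists (fun x => step p' q' x - step p q x); split.
  - apply: elementary_add; first exact: elementary_step.
    exact/elementary_opp/elementary_step.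
  - move=> x; rewrite negb_and -!ltNge => /orP[xp|qx].
      by rewrite !step_le ?subr0//; lra.
    by rewrite !step_ge ?subrr//; lra.
  - apply/funext => x; rewrite -!step_derive1// !derive1E deriveB//.
      exact/elementary_derivable/elementary_step.
    exact/elementary_derivable/elementary_step.
move=> h1 h2 h3 h4 h5 h6.
have [a [ea a0 da]] := window _ _ _ _ h1 h2 h3.
have [b [eb b0 db]] := window _ _ _ _ h4 h5 h6.
have ab : tensor a b \in @test_pred R.
  by apply/asboolP; split; [exact: tensor_smooth|exact: tensor_supp a0 b0].
exists (TestFun ab) => z /=.
rewrite (pder_tensor false)// (pder_tensor true)//; last first.
  exact: elementary_derive1.
by rewrite da db.
Qed.

End tensor_products.

(** * Uniqueness of the primitive *)

Section uniqueness.
Context (R : realType).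
Implicit Types (F G : Bc R).

Lemma nbhs_real_right (x : R) (A : set (\bar R)) : nbhs x%:E A ->
  exists2 q, x < q & forall t, x <= t <= q -> A t%:E.
Proof.
move=> [e /= e0 xA]; exists (x + e / 2); first by rewrite ltrDl divr_gt0.
move=> t /andP[xt tq]; apply: xA => /=.
by rewrite ler0_norm ?subr_le0// opprB; lra.
Qed.

Lemma nbhs_ninfty_left (x : R) (A : set (\bar R)) : nbhs -oo%E A ->
  exists p q, [/\ p < q, q <= x & forall t, p <= t <= q -> A t%:E].
Proof.
move=> [M [_ MA]]; pose q := Num.min (M - 1) x.
exists (q - 1), q; split; first by lra.
  by rewrite /q ge_min lexx orbT.
move=> t /andP[_ tq]; apply: MA; rewrite lte_fin.
by move: tq; rewrite /q le_min => /andP[]; lra.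
Qed.

(** Testing against a product of plateaus equates an alternating sum of four
    averages of [F] to zero; three of the boxes can be pushed towards the
    boundary at minus infinity, where [F] vanishes. *)
Lemma der12_eq0_fin F : der12 F = 0 -> forall x y : R, F (x%:E, y%:E) = 0.
Proof.
move=> F0 x y; apply/eqP; rewrite -normr_le0; apply/ler_addgt0Pl => e e0.
rewrite addr0.
(* One quarter of [e] is allotted to each of the four averages. *)
pose d := e / 4.
have d0 : 0 < d by rewrite divr_gt0.
have near_box (X Y : \bar R) : exists A B, [/\ nbhs X A, nbhs Y B &
    forall s t, A s -> B t -> `|F (s, t) - F (X, Y)| <= d].
  have /cvgrPdist_lt/(_ _ d0) := @Bc_continuous R F (X, Y).
  move=> [[A B] /= [XA YB] AB]; exists A, B; split=> // s t As Bt.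
  by rewrite distrC ltW//; apply: (AB (s, t)).
have [A [B [xA yB AB]]] := near_box x%:E y%:E.
have [A1 [B1 [xA1 yB1 AB1]]] := near_box -oo%E y%:E.
have [A2 [B2 [xA2 yB2 AB2]]] := near_box x%:E -oo%E.
have [A3 [B3 [xA3 yB3 AB3]]] := near_box -oo%E -oo%E.
(* The two boxes sharing a coordinate interval must use the same one, hence
   the intersections of neighbourhoods. *)
have [q xq Aq] := nbhs_real_right (filterI xA xA2).
have [s ys Bs] := nbhs_real_right (filterI yB yB1).
have [p1 [q1 [pq1 qx Aq1]]] := nbhs_ninfty_left x (filterI xA1 xA3).
have [r1 [s1 [rs1 sy Bs1]]] := nbhs_ninfty_left y (filterI yB2 yB3).
have [phi phiE] := window_test_function pq1 qx xq rs1 sy ys.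
have cF := @on_plane_continuous R F.
pose I p q r s :=
  \int[@mu2 R]_z (on_plane F z * tensor (pulse p q) (pulse r s) z).
have : I p1 q1 r1 s1 - I p1 q1 y s - (I x q r1 s1 - I x q y s) = 0.
  have : der12 F phi = 0 by rewrite F0.
  rewrite der12E /regular_fun => <-.
  have i11 := box_integrable pq1 rs1 cF; have i10 := box_integrable pq1 ys cF.
  have i01 := box_integrable xq rs1 cF; have i00 := box_integrable xq ys cF.
  have i1 := integrableB measurableT i11 i10.
  have i0 := integrableB measurableT i01 i00.
  have := RintegralB measurableT i1 i0.
  rewrite (RintegralB measurableT i11 i10).
  rewrite (RintegralB measurableT i01 i00) => <-.
  by apply: eq_Rintegral => z _; rewrite phiE /tensor; ring.
have h : `|I x q y s - F (x%:E, y%:E)| <= d.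
  apply: box_average => // s' t' /Aq[? ?] /Bs[? ?]; exact: AB.
have h1 : `|I p1 q1 y s - 0| <= d.
  rewrite -(Bc_boundary F y%:E).1.
  apply: box_average => // s' t' /Aq1[? ?] /Bs[? ?]; exact: AB1.
have h2 : `|I x q r1 s1 - 0| <= d.
  rewrite -(Bc_boundary F x%:E).2.
  apply: box_average => // s' t' /Aq[? ?] /Bs1[? ?]; exact: AB2.
have h3 : `|I p1 q1 r1 s1 - 0| <= d.
  rewrite -(Bc_boundary F -oo%E).1.
  apply: box_average => // s' t' /Aq1[? ?] /Bs1[? ?]; exact: AB3.
have -> : e = 4 * d by rewrite /d; field.
move: h h1 h2 h3; move: (I x q y s) (I p1 q1 y s) (I x q r1 s1) (I p1 q1 r1 s1).
move: (F _) => v i i1 i2 i3; rewrite !subr0 ler_distl !ler_norml.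
move=> /andP[? ?] /andP[? ?] /andP[? ?] /andP[? ?] ?.
by apply/andP; split; lra.
Qed.

Lemma nbhs_real_point (X : \bar R) (A : set (\bar R)) : nbhs X A ->
  exists x : R, A x%:E.
Proof.
case: X => [x xA|[M [_ MA]]|[M [_ MA]]].
- by exists x; exact: nbhs_singleton xA.
- by exists (M + 1); apply: MA; rewrite lte_fin ltrDl.
- by exists (M - 1); apply: MA; rewrite lte_fin ltrBlDr ltrDl.
Qed.

(** The real plane is dense in the extended plane. *)
Lemma Bc_eq0_fin F : (forall x y : R, F (x%:E, y%:E) = 0) -> F = 0.
Proof.
move=> F0; apply: Bc_ext => -[X Y]; apply/eqP; rewrite -normr_le0.
apply/ler_addgt0Pl => e e0; rewrite addr0.
have /cvgrPdist_lt/(_ _ e0) := @Bc_continuous R F (X, Y).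
move=> [[A B] /= [XA YB] AB].
have [x Ax] := nbhs_real_point XA; have [y By] := nbhs_real_point YB.
by have /= := AB (x%:E, y%:E) (conj Ax By); rewrite F0 subr0 => /ltW.
Qed.

Lemma der12_inj : injective (@der12 R).
Proof.
move=> F G FG; apply/eqP; rewrite -subr_eq0; apply/eqP.
apply/Bc_eq0_fin/der12_eq0_fin.
by rewrite addrC -scaleN1r der12_lin FG scaleN1r addNr.
Qed.

End uniqueness.

(** * Transport along an isometric isomorphism *)

Section transport.
Context (R : realType) (V W : lmodType R).
Context (nrmV : V -> R) (mulV : V -> V -> V).
Context (nrmW : W -> R) (mulW : W -> W -> W).
Context (h : {linear V -> W}) (k : W -> V).
Context (hK : cancel h k) (kK : cancel k h).
Context (hM : forall u v, h (mulV u v) = mulW (h u) (h v)).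
Context (hN : forall v, nrmW (h v) = nrmV v).

Lemma transport_comm_banach_algebra :
  comm_banach_algebra nrmW mulW -> comm_banach_algebra nrmV mulV.
Proof.
have hi := can_inj hK.
case=> n0 nd nZ nD nC ml mr mA mC nM; split.
- by move=> v; rewrite -hN.
- by move=> v; rewrite -hN => /nd h0; apply: hi; rewrite h0 linear0.
- by move=> a v; rewrite -!hN linearZ nZ.
- by move=> u v; rewrite -!hN linearD.
- move=> u uC; have [|w uw] := nC (h \o u).
    by move=> e /uC[N uN]; exists N => m n /uN /[apply]; rewrite -hN linearB.
  exists (k w); apply: cvg_trans uw; apply: near_eq_cvg; near=> n.
  by rewrite -hN linearB /= kK.
- by move=> a u v w; apply: hi; rewrite hM !linearP ml !hM.
- by move=> a u v w; apply: hi; rewrite hM !linearP mr !hM.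
- by move=> u v w; apply: hi; rewrite !hM mA.
- by move=> u v; apply: hi; rewrite !hM mC.
- by move=> u v; rewrite -!hN hM.
Unshelve. all: by end_near. Qed.

Lemma transport_unit : has_unit mulV -> has_unit mulW.
Proof.
case=> e [le re]; exists (h e); split=> w; rewrite -[w]kK -hM.
  by rewrite le.
by rewrite re.
Qed.

Lemma transport_approximate_identity :
  has_approximate_identity nrmW mulW -> has_approximate_identity nrmV mulV.
Proof.
case=> u uP; exists (k \o u) => v; have := uP (h v).
by under eq_fun do rewrite -[X in mulW X _]kK -hM -linearB hN.
Qed.

End transport.

(** * Integrable distributions *)
Section primitives.
Context (R : realType).
Implicit Types (F G : Bc R) (f g : Ac R).

Lemma primitiveK : cancel (@primitive R) (@Ac_der12 R).
Proof. by move=> f; exact: projT2 (cid (primitive_subproof f)). Qed.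

Lemma Ac_der12K : cancel (@Ac_der12 R) (@primitive R).
Proof.
move=> F; apply: der12_inj.
by have /(congr1 (@Ac_val R)) := primitiveK (Ac_der12 F).
Qed.

Lemma primitive_linear : linear (@primitive R).
Proof.
move=> a f g; apply: der12_inj; rewrite der12_lin.
have E (x : Ac R) : der12 (primitive x) = Ac_val x.
  by have /(congr1 (@Ac_val R)) := primitiveK x.
by rewrite !E.
Qed.

HB.instance Definition _ := GRing.isLinear.Build R (Ac R) (Bc R) *:%R
  (@primitive R) primitive_linear.

Lemma primitive_mul f g :
  primitive (Ac_mul f g) = Bc_mul (primitive f) (primitive g).
Proof. exact: Ac_der12K. Qed.

End primitives.

Theorem theorem12p1 (R : realType) :
  [/\ forall F1 F2 : Bc R,
        Ac_mul (Ac_der12 F1) (Ac_der12 F2) = Ac_der12 (Bc_mul F1 F2),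
      comm_banach_algebra (@alexiewicz_norm R) (@Ac_mul R),
      ~ has_unit (@Ac_mul R),
      has_approximate_identity (@alexiewicz_norm R) (@Ac_mul R) &
      banach_algebra_isomorphic (@alexiewicz_norm R) (@Ac_mul R)
        (@sup_norm R) (@Bc_mul R)].
Proof.
pose h : {linear Ac R -> Bc R} := @primitive R.
have hK : cancel h (@Ac_der12 R) := @primitiveK R.
have kK : cancel (@Ac_der12 R) h := @Ac_der12K R.
have hM f g : h (Ac_mul f g) = Bc_mul (h f) (h g) by exact: primitive_mul.
have hN f : sup_norm (h f) = alexiewicz_norm f by [].
split.
- by move=> F G; rewrite /Ac_mul !Ac_der12K.
- exact: transport_comm_banach_algebra hK kK hM hN (Bc_comm_banach_algebra R).
- by move=> /(transport_unit kK hM); exact: Bc_no_unit.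
- exact: transport_approximate_identity kK hM hN (Bc_approximate_identity R).
- by exists h; split=> //; exists (@Ac_der12 R).
Qed.
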